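(* Let $q$ be an indeterminate and let $m,n,r\geq 0$ and $k\ge0$ be integers. Then $$S_q^{(m+r)}(n,k)=\sum_{i=0}^n q^{m(i+r)+\binom{m}{2}}m_q^{\,n-i}\binom{n}{i}S_q^{(r)}(i,k),$$ $$L_q^{(m+r)}(n,k)=\sum_{i=0}^n q^{m(2i+2r+m-1)}[2m]_q^{\overline{n-i}}\binom{n}{i}_qL_q^{(r)}(i,k),$$ and $$c_q^{(m+r)}(n,k)=\sum_{i=0}^n q^{r(n-i)}m_q^{\overline{n-i}}\binom{n}{i}_qc_q^{(r)}(i,k).$$
   Context: For an integer $a\ge1$, $a_q=[a]_q=1+q+\cdots+q^{a-1}$, $0_q=0$, $a_q!=\prod_{i=1}^a i_q$, $0_q!=1$; $\binom{n}{k}_q=\frac{n_q!}{k_q!(n-k)_q!}$ for $0\le k\le n$, $\binom{n}{0}_q=1$ for all $n$, $0$ otherwise; $[a]_q^{\overline{b}}=\prod_{i=a}^{a+b-1}i_q$ for $b\ge1$, $[a]_q^{\overline{0}}=1$. Inversions of a word: pairs of positions $s<t$ with the letter at $s$ larger than that at $t$. (Partitions) For a set partition $\pi=B_1/\cdots/B_k$ with $\min B_1<\cdots<\min B_k$, $w(\pi)=\sum_{i=1}^k(i-1)|B_i|$. For $s\ge0$, $S_q^{(s)}(n,k)=\sum q^{w(\pi)}$ over partitions $\pi$ of $[n+s]$ into $k+s$ blocks with $1,\dots,s$ in distinct blocks. (Lah distributions) A Lah distribution is a set partition with each block linearly ordered. For one with $k$ blocks, write the blocks as words $W_1,\dots,W_k$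 in decreasing order of least elements and let $\mathrm{inv}_\rho$ be the number of inversions of $W_1\,0\,W_2\,0\cdots0\,W_k$. For $s\ge0$, $L_q^{(s)}(n,k)=\sum q^{\mathrm{inv}_\rho(\delta)}$ over Lah distributions $\delta$ of $[n+s]$ into $k+s$ blocks with $1,\dots,s$ in distinct blocks. (Permutations) Write a permutation in standard cycle form (each cycle begins with its minimum, cycles ordered by increasing minima), erase cycle dividers, and let $\mathrm{inv}_c$ be the number of inversions of the resulting word. For $s\ge0$, $c_q^{(s)}(n,k)=\sum q^{\mathrm{inv}_c(\pi)}$ over permutations $\pi$ of $[n+s]$ with $k+s$ cycles and $1,\dots,s$ in distinct cycles. *)

(* Defs.v *)
From HB Require Import structures.
From mathcomp Require Import all_boot all_order all_fingroup all_algebra.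
From mathcomp Require Import ring.

Set Implicit Arguments.
Unset Strict Implicit.
Unset Printing Implicit Defensive.

Import GRing.Theory.

Local Open Scope ring_scope.

(* The indeterminate q is the variable 'X of {poly int}. *)

Definition qnum (a : nat) : {poly int} := \sum_(i < a) 'X^i.

Definition qfact (a : nat) : {poly int} := \prod_(1 <= i < a.+1) qnum i.

Definition qrising (a b : nat) : {poly int} := \prod_(a <= i < a + b) qnum i.

(* The divisor is monic and the division exact: see qbinomE below. *)
Definition qbinom (n k : nat) : {poly int} :=
  if (k <= n)%N then qfact n %/ (qfact k * qfact (n - k)) else 0.

Definition inv (w : seq nat) : nat :=
  #|[set p : 'I_(size w) * 'I_(size w) |
      (p.1 < p.2)%N && (nth 0%N w p.2 < nth 0%N w p.1)%N]|.

(* The ground set [N] = {1, ..., N} is 'I_N, with x : 'I_N standing for x + 1;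
   in particular the elements 1, ..., s are the x with x < s. *)

Definition distinct_blocks (N s : nat) (P : {set {set 'I_N}}) : bool :=
  [forall x : 'I_N, forall y : 'I_N,
     [&& x < s, y < s & x != y]%N ==> (pblock P x != pblock P y)].

Definition minb (N : nat) (B : {set 'I_N}) : nat :=
  \big[minn/N]_(x in B) (x : nat).

Definition blocks (N : nat) (P : {set {set 'I_N}}) : seq {set 'I_N} :=
  sort (fun B C => minb B <= minb C)%N (enum P).

Definition wpart (N : nat) (P : {set {set 'I_N}}) : nat :=
  (\sum_(i < size (blocks P)) i * #|nth set0 (blocks P) i|)%N.

Definition Sq (s n k : nat) : {poly int} :=
  \sum_(P : {set {set 'I_(n + s)}} |
        [&& partition P [set: 'I_(n + s)], #|P| == (k + s)%N
          & distinct_blocks s P])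
    'X^(wpart P).

(* Lah distributions: a linearly ordered block is a duplicate-free word, and a
   Lah distribution is a set of such words whose supports are the blocks of a
   set partition, each block being the support of just one of the words. *)

Definition supp (N : nat) (W : N.-bseq 'I_N) : {set 'I_N} := [set x in W].

Definition underlying (N : nat) (D : {set N.-bseq 'I_N}) : {set {set 'I_N}} :=
  [set supp W | W in D].

Definition is_lah (N : nat) (D : {set N.-bseq 'I_N}) : bool :=
  [&& partition (underlying D) [set: 'I_N],
      [forall W in D, uniq W]
    & [forall V in D, forall W in D, (supp V == supp W) ==> (V == W)]].

Definition lah_words (N : nat) (D : {set N.-bseq 'I_N}) : seq (N.-bseq 'I_N) :=
  sort (fun V W => minb (supp V) >= minb (supp W))%N (enum D).

(* W_1 0 W_2 0 ... 0 W_k, the letters of the W_i being shifted to 1, ..., N. *)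
Definition lah_word (N : nat) (D : {set N.-bseq 'I_N}) : seq nat :=
  behead (flatten
    [seq 0%N :: [seq (val x).+1 | x <- val W] | W <- lah_words D]).

Definition Lq (s n k : nat) : {poly int} :=
  \sum_(D : {set (n + s).-bseq 'I_(n + s)} |
        [&& is_lah D, #|D| == (k + s)%N & distinct_blocks s (underlying D)])
    'X^(inv (lah_word D)).

(* enum 'I_N is increasing, so the cycles come by increasing minima. *)
Definition cycle_minima (N : nat) (p : {perm 'I_N}) : seq 'I_N :=
  [seq x <- enum 'I_N | [forall y in porbit p x, x <= y]%N].

Definition cycle_word (N : nat) (p : {perm 'I_N}) : seq nat :=
  flatten [seq [seq val y | y <- traject p x #|porbit p x|]
             | x <- cycle_minima p].

Definition cq (s n k : nat) : {poly int} :=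
  \sum_(p : {perm 'I_(n + s)} |
        (#|porbits p| == (k + s)%N) && distinct_blocks s (porbits p))
    'X^(inv (cycle_word p)).

Lemma qnumS (a : nat) : qnum a.+1 = qnum a + 'X^a.
Proof. by rewrite /qnum big_ord_recr. Qed.

Lemma qnumD (a b : nat) : qnum (a + b) = qnum a + 'X^a * qnum b.
Proof.
elim: b => [|b IH]; first by rewrite addn0 /qnum big_ord0 mulr0 addr0.
by rewrite addnS !qnumS IH mulrDr -exprD addrA.
Qed.

Lemma qfact0 : qfact 0 = 1.
Proof. by rewrite /qfact big_geq. Qed.

Lemma qfactS (a : nat) : qfact a.+1 = qfact a * qnum a.+1.
Proof. by rewrite /qfact big_nat_recr. Qed.

Lemma qnum_monic (a : nat) : qnum a.+1 \is monic.
Proof.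
have -> : qnum a.+1 = \poly_(i < a.+1) 1.
  by rewrite poly_def; apply: eq_bigr => i _; rewrite scale1r.
by rewrite monicE lead_coef_poly ?oner_eq0.
Qed.

Lemma qfact_monic (a : nat) : qfact a \is monic.
Proof.
elim: a => [|a IH]; first by rewrite qfact0 rpred1.
by rewrite qfactS rpredM ?qnum_monic.
Qed.

Lemma qbinom_exact (a b : nat) :
  exists g : {poly int}, qfact (a + b) = g * (qfact a * qfact b).
Proof.
have [n] := ubnP (a + b); elim: n a b => // n IH [|a] [|b] ltn.
- by exists 1; rewrite qfact0 !mulr1.
- by exists 1; rewrite qfact0 !mul1r.
- by exists 1; rewrite qfact0 addn0 mulr1 mul1r.
have [|g Eg] := IH a b.+1; first by rewrite addSn in ltn.
have [|h Eh] := IH a.+1 b; first by rewrite addnS in ltn.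
exists (g + 'X^(a.+1) * h); rewrite addSn qfactS -addSn qnumD mulrDr.
rewrite {1}Eg addnS -addSn Eh (qfactS a) (qfactS b).
by ring.
Qed.

Lemma qbinomE (n k : nat) : (k <= n)%N ->
  qbinom n k * (qfact k * qfact (n - k)) = qfact n.
Proof.
move=> le_kn; rewrite /qbinom le_kn.
have [g] := qbinom_exact k (n - k); rewrite subnKC // => ->.
by rewrite Pdiv.IdomainMonic.mulpK // rpredM ?qfact_monic.
Qed.

(* Main.v *)
Require Import Defs.
From mathcomp Require Import all_boot all_order all_fingroup all_algebra.
From mathcomp Require Import zify ring.

(** Each of the three structures is encoded by the list of its blocks,
    written as words and ordered by increasing minima: the words are increasing
    for set partitions, start with their least letter for permutations, and are
    arbitrary for Lah distributions.  Deleting the largest letter turns such a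
    list into one with a letter fewer; conversely the new letter either forms a
    new last block or is inserted somewhere in an existing block.  Following the
    statistic through the insertion gives, with N letters and K blocks in total,

      A (N + 1, K) = q^(a N (K - 1)) A (N, K - 1) + [b N K]_q A (N, K),

    the second term being absent while N < s, since the first s elements lie in
    distinct blocks.  Here (a N K, b N K) is (K, K) for partitions,
    (N + K, N + K) for Lah distributions and (0, N) for permutations.  The
    Pascal recurrence, ordinary or q-analogue, makes the right-hand sides of
    the theorem satisfy the recurrence of the left-hand sides. *)

Set Implicit Arguments.
Unset Strict Implicit.
Unset Printing Implicit Defensive.

Import GRing.Theory Num.Theory.

Local Open Scope ring_scope.

(** * Triangular recurrences *)

Section TriangularRecurrence.

Variable R : comPzSemiRingType.
Implicit Types f g t u v : nat -> nat -> R.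

Definition triangular_rec u v f : Prop := forall n k,
  f n.+1 k = (if k is k'.+1 then u n k' * f n k' else 0) + v n k * f n k.

Lemma triangular_rec_scale d t u v u' v' :
    (forall n i, (n < i)%N -> t n i = 0) ->
    (forall n i, (i <= n)%N -> d n.+1 i.+1 * u n i = u' n i * d n i) ->
    (forall n i, (i <= n)%N -> d n.+1 i * v n i = v' n i * d n i) ->
  triangular_rec u v t -> triangular_rec u' v' (fun n i => d n i * t n i).
Proof.
move=> t_gt d_diag d_col tS n i; rewrite tS mulrDr; congr (_ + _); last first.
  have [le_in|lt_ni] := leqP i n; last by rewrite t_gt ?mulr0.
  by rewrite !mulrA d_col.
case: i => [|i]; first by rewrite mulr0.
have [le_in|lt_ni] := leqP i n; last by rewrite t_gt ?mulr0.
by rewrite !mulrA d_diag.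
Qed.

(* Both sides satisfy the recurrence of [g] in [n]. *)
Lemma triangular_rec_transfer c f g uc vc uf vf ug vg :
    (forall n i, (n < i)%N -> c n i = 0) ->
    (forall n i k, (i <= n)%N -> uc n i * uf i k = ug n k) ->
    (forall n i k, (i <= n)%N -> vc n i + uc n i * vf i k = vg n k) ->
    triangular_rec uc vc c -> triangular_rec uf vf f ->
    triangular_rec ug vg g -> (forall k, g 0%N k = c 0%N 0%N * f 0%N k) ->
  forall n k, g n k = \sum_(0 <= i < n.+1) c n i * f i k.
Proof.
move=> c_gt u_comp v_comp cS fS gS g0.
elim=> [|n IH] k; first by rewrite big_nat1 g0.
transitivity (\sum_(0 <= i < n.+1)
    (uc n i * c n i * f i.+1 k + vc n i * c n i * f i k)); last first.
  rewrite big_split /=.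
  under [RHS]eq_bigr => i _ do rewrite cS mulrDl.
  rewrite big_split [X in _ = X + _]big_nat_recl //= mul0r add0r.
  by congr (_ + _); rewrite [RHS]big_nat_recr //= c_gt // mulr0 mul0r addr0.
rewrite gS IH; case: k => [|k]; rewrite ?add0r ?IH !mulr_sumr -?big_split /=;
  apply: eq_big_nat => i; rewrite ltnS => le_in;
  rewrite fS -(v_comp n i) //; first by ring.
by rewrite -(u_comp n i) //; ring.
Qed.

End TriangularRecurrence.

(** * q-analogues *)

Lemma qnum0 : qnum 0 = 0.
Proof. by rewrite /qnum big_ord0. Qed.

Lemma qnum1 : qnum 1 = 1.
Proof. by rewrite /qnum big_ord1. Qed.

Lemma horner_qnum1 n : (qnum n).[1] = n%:R.
Proof.
rewrite horner_sum; under eq_bigr do rewrite hornerXn expr1n.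
by rewrite sumr_const card_ord.
Qed.

Lemma qnum_rev n : \sum_(0 <= i < n) 'X^(n - i.+1) = qnum n.
Proof.
by rewrite /qnum -(big_mkord xpredT (fun i => 'X^i)) [RHS]big_nat_rev.
Qed.

Lemma qnum_sum_take (T : Type) (x0 : T) (mu : T -> nat) s :
  \sum_(0 <= i < size s) 'X^(\sum_(x <- take i s) mu x) * qnum (mu (nth x0 s i))
    = qnum (\sum_(x <- s) mu x).
Proof.
elim: s => [|x s IH]; first by rewrite big_geq // big_nil qnum0.
rewrite /= big_nat_recl //= big_nil mul1r big_cons qnumD -IH mulr_sumr.
congr (_ + _); apply: eq_bigr => i _.
by rewrite big_cons exprD mulrA.
Qed.

Lemma qnum_sum_drop (T : Type) (x0 : T) (mu : T -> nat) s :
  \sum_(0 <= i < size s)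
      'X^(\sum_(x <- drop i.+1 s) mu x) * qnum (mu (nth x0 s i))
    = qnum (\sum_(x <- s) mu x).
Proof.
elim: s => [|x s IH]; first by rewrite big_geq // big_nil qnum0.
by rewrite /= big_nat_recl //= drop0 IH big_cons addnC qnumD addrC.
Qed.

Lemma qrising0 a : qrising a 0 = 1.
Proof. by rewrite /qrising addn0 big_geq. Qed.

Lemma qrisingS a b : qrising a b.+1 = qrising a b * qnum (a + b).
Proof. by rewrite /qrising addnS big_nat_recr ?leq_addr. Qed.

Lemma qfact_neq0 n : qfact n != 0.
Proof. exact/monic_neq0/qfact_monic. Qed.

Lemma qbinom_small n k : (n < k)%N -> qbinom n k = 0.
Proof. by move=> lt_nk; rewrite /qbinom leqNgt lt_nk. Qed.

Lemma qbinom_sub n k : (k <= n)%N -> qbinom n (n - k) = qbinom n k.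
Proof. by move=> le_kn; rewrite /qbinom leq_subr le_kn subKn // mulrC. Qed.

Lemma qbinomn0 n : qbinom n 0 = 1.
Proof.
apply: (mulIf (qfact_neq0 n)).
by rewrite mul1r -[in RHS](qbinomE (leq0n n)) subn0 qfact0 mul1r.
Qed.

Lemma qbinomnn n : qbinom n n = 1.
Proof. by rewrite -[X in qbinom _ X]subn0 qbinom_sub ?qbinomn0. Qed.

Lemma qbinomS n i : (i <= n)%N ->
  qbinom n.+1 i.+1 = qbinom n i.+1 + 'X^(n - i) * qbinom n i.
Proof.
rewrite leq_eqVlt => /orP[/eqP->|lt_in].
  by rewrite !qbinomnn qbinom_small // subnn mulr1 add0r.
apply: (mulIf (mulf_neq0 (qfact_neq0 i.+1) (qfact_neq0 (n - i)))).
rewrite -[in LHS]subSS qbinomE 1?ltnW // mulrDl.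
transitivity (qfact n * qnum (n - i) + 'X^(n - i) * (qfact n * qnum i.+1)).
  have -> : n.+1 = (n - i + i.+1)%N by lia.
  by rewrite addnS qfactS -addnS subnK 1?ltnW // qnumD; ring.
rewrite -{1}(qbinomE lt_in) -(qbinomE (ltnW lt_in)) -(subnSK lt_in) !qfactS.
by ring.
Qed.

Lemma qbinomS_sym n i : (i <= n)%N ->
  qbinom n.+1 i.+1 = 'X^(i.+1) * qbinom n i.+1 + qbinom n i.
Proof.
rewrite leq_eqVlt => /orP[/eqP->|lt_in].
  by rewrite !qbinomnn qbinom_small // mulr0 add0r.
rewrite -qbinom_sub 1?ltnW // subSS -(subnSK lt_in) qbinomS ?leq_subr //.
by rewrite subKn // qbinom_sub // subnSK // qbinom_sub 1?addrC 1?ltnW.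
Qed.

Lemma qbinom_rec :
  @triangular_rec {poly int} (fun n i => 'X^(n - i)) (fun _ _ => 1) qbinom.
Proof.
move=> n [|i]; first by rewrite !qbinomn0 add0r mul1r.
rewrite mul1r addrC; have [/qbinomS//|lt_ni] := leqP i n.
by rewrite !qbinom_small ?mulr0 ?addr0 ?ltnS // ltnW.
Qed.

Lemma qbinom_rec_sym :
  @triangular_rec {poly int} (fun _ _ => 1) (fun _ i => 'X^i) qbinom.
Proof.
move=> n [|i]; first by rewrite !qbinomn0 add0r mul1r.
rewrite mul1r addrC; have [/qbinomS_sym//|lt_ni] := leqP i n.
by rewrite !qbinom_small ?mulr0 ?addr0 ?ltnS // ltnW.
Qed.

Lemma bin_rec (R : comPzSemiRingType) :
  @triangular_rec R (fun _ _ => 1) (fun _ _ => 1) (fun n i => 'C(n, i)%:R).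
Proof.
by move=> n [|i]; rewrite ?bin0 ?binS ?natrD !mul1r ?add0r // addrC.
Qed.

(** * Ordered lists of blocks *)

Definition min_letter (c : seq nat) : nat := foldr minn (head 0%N c) c.

Lemma min_letter_le c x : x \in c -> (min_letter c <= x)%N.
Proof.
rewrite /min_letter; elim: c (head _ _) => //= y c IH z.
by rewrite inE geq_min => /predU1P[->|/IH->]; rewrite ?leqnn ?orbT.
Qed.

Lemma min_letter_mem c : c != [::] -> min_letter c \in c.
Proof.
have foldr_mem y s : foldr minn y s \in y :: s.
  elim: s => [|z s IH] /=; first by rewrite mem_head.
  rewrite /minn; case: ifP => _; first by rewrite !inE eqxx orbT.
  by move: IH; rewrite !inE => /orP[->//|->]; rewrite !orbT.
case: c => // x c _.
by have := foldr_mem x (x :: c); rewrite !inE orbA orbb.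
Qed.

Lemma min_letterE c x : x \in c -> all (leq x) c -> min_letter c = x.
Proof.
move=> xc /allP x_le; apply/anti_leq; rewrite min_letter_le //=.
by apply/x_le/min_letter_mem; case: (c) xc.
Qed.

Lemma min_letter_insert_max N c1 c2 :
    c1 ++ c2 != [::] -> all (ltn^~ N) (c1 ++ c2) ->
  min_letter (c1 ++ N :: c2) = min_letter (c1 ++ c2).
Proof.
set c := c1 ++ c2 => c_neq0 /allP c_lt; have minc := min_letter_mem c_neq0.
have mem_ins x : (x \in c1 ++ N :: c2) = (x == N) || (x \in c).
  by rewrite !mem_cat inE orbCA.
apply: min_letterE; first by rewrite mem_ins minc orbT.
apply/allP => x; rewrite mem_ins => /predU1P[->|/min_letter_le//].
exact/ltnW/c_lt.
Qed.

Definition block_list (N : nat) (L : seq (seq nat)) : bool :=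
  [&& perm_eq (flatten L) (iota 0 N), [::] \notin L
    & sorted ltn [seq min_letter c | c <- L]].

Section BlockList.

Variables (N : nat) (L : seq (seq nat)).
Hypothesis blockL : block_list N L.

Lemma block_list_uniq : uniq (flatten L).
Proof. by case/and3P: blockL => /perm_uniq->; rewrite iota_uniq. Qed.

Lemma mem_flatten_block_list x : (x \in flatten L) = (x < N)%N.
Proof. by case/and3P: blockL => /perm_mem-> _ _; rewrite mem_iota. Qed.

Lemma size_flatten_block_list : size (flatten L) = N.
Proof. by case/and3P: blockL => /perm_size->; rewrite size_iota. Qed.

Lemma block_list_all_lt : all (all (ltn^~ N)) L.
Proof.
apply/allP => c cL; apply/allP => x xc /=.
by rewrite -mem_flatten_block_list; apply/flattenP; exists c.
Qed.

Lemma block_lt c : c \in L -> all (ltn^~ N) c.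
Proof. exact: allP block_list_all_lt c. Qed.

Lemma block_neq_nil c : c \in L -> c != [::].
Proof. by case/and3P: blockL => _ nilL _ cL; apply: contraNneq nilL => <-. Qed.

Lemma block_uniq c : c \in L -> uniq c.
Proof.
move=> cL; have := block_list_uniq; case/splitPr: cL => A B.
by rewrite flatten_cat /= !cat_uniq => /and3P[_ _ /andP[]].
Qed.

Lemma eq_block c d x : c \in L -> d \in L -> x \in c -> x \in d -> c = d.
Proof.
move=> cL dL xc xd; have := block_list_uniq.
case/splitPr: cL dL => A B; rewrite mem_cat inE flatten_cat /= !cat_uniq.
case/or3P=> [dA|/eqP->//|dB].
- case/and3P=> _ /hasP[]; exists x; first by rewrite mem_cat xc.
  by apply/flattenP; exists d.
- case/and5P=> _ _ _ /hasP[] //; exists x => //.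
  by apply/flattenP; exists d.
Qed.

End BlockList.

Lemma block_list_eq N L M : block_list N L -> block_list N M -> L =i M -> L = M.
Proof.
case/and3P=> _ _ sL /and3P[_ _ sM].
apply: (@irr_sorted_eq _ (relpre min_letter ltn)); rewrite -?sorted_map //.
- by move=> d c e; apply: ltn_trans.
- by move=> c; apply: ltnn.
Qed.

Lemma perm_iota_max N l :
  perm_eq (N :: l) (iota 0 N.+1) = perm_eq l (iota 0 N).
Proof.
rewrite -[N.+1]addn1 iotaD cats1 (permPr (permEl (perm_rcons _ _))).
exact: perm_cons.
Qed.

Lemma block_list_insert_max N A B c1 c2 : c1 ++ c2 != [::] ->
  block_list N.+1 (A ++ (c1 ++ N :: c2) :: B) =
    block_list N (A ++ (c1 ++ c2) :: B).
Proof.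
move=> c_neq0; rewrite /block_list.
have permN : perm_eq (flatten (A ++ (c1 ++ N :: c2) :: B))
                     (N :: flatten (A ++ (c1 ++ c2) :: B)).
  rewrite !flatten_cat /= -!catA !(catA (flatten A) c1).
  by rewrite -[(N :: c2) ++ _]cat1s perm_catCA.
rewrite (permPl permN) perm_iota_max.
have [permL|//] := boolP (perm_eq _ (iota 0 N)).
rewrite !map_cat /= min_letter_insert_max //; last first.
  apply/allP => x xc; suff: x \in iota 0 N by rewrite mem_iota.
  by rewrite -(perm_mem permL) flatten_cat /= !mem_cat -mem_cat xc orbT.
by rewrite !mem_cat !inE !(eq_sym [::]) (negbTE c_neq0); case: (c1).
Qed.

Lemma block_list_rcons N L :
  block_list N.+1 (rcons L [:: N]) = block_list N L.
Proof.
rewrite /block_list flatten_rcons cats1 perm_rcons perm_iota_max.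
have [permL|//] := boolP (perm_eq _ _).
rewrite mem_rcons inE /= map_rcons; have [|nilL] //= := boolP ([::] \in L).
rewrite !(sorted_pairwise ltn_trans) pairwise_rcons [min_letter _]minnn.
rewrite andb_idl // => _; apply/allP => _ /mapP[c cL ->].
suff: min_letter c \in iota 0 N by rewrite mem_iota.
rewrite -(perm_mem permL); apply/flattenP; exists c => //.
by apply: min_letter_mem; apply: contraNneq nilL => <-.
Qed.

Definition insertions (N : nat) (L : seq (seq nat)) : seq (seq (seq nat)) :=
  [seq take i L ++ (take j (nth [::] L i) ++ N :: drop j (nth [::] L i))
         :: drop i.+1 L
     | i <- index_iota 0 (size L), j <- index_iota 0 (size (nth [::] L i)).+1].

Variant insertion_spec (N : nat) (L M : seq (seq nat)) : Prop :=
  InsertionSpec A c1 c2 B of L = A ++ (c1 ++ c2) :: B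
    & M = A ++ (c1 ++ N :: c2) :: B.

Lemma insertionsP N L M : reflect (insertion_spec N L M) (M \in insertions N L).
Proof.
apply: (iffP allpairsPdep) => [[i [j [iL _ ->]]]|[A c1 c2 B -> ->]].
  rewrite mem_index_iota /= in iL; econstructor; last by [].
  by rewrite cat_take_drop -drop_nth // cat_take_drop.
exists (size A), (size c1).
rewrite nth_cat ltnn subnn /= !take_size_cat // drop_size_cat //.
rewrite -cat_rcons drop_size_cat ?size_rcons // !mem_index_iota.
by rewrite !size_cat size_rcons ltnS !leq_addr.
Qed.

Lemma size_insertions N L M : M \in insertions N L -> size M = size L.
Proof. by case/insertionsP=> A c1 c2 B -> ->; rewrite !size_cat. Qed.

Lemma uniq_insertions N L : N \notin flatten L -> uniq (insertions N L).
Proof.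
move=> N_notin; have N_block i : N \notin nth [::] L i.
  have [iL|iL] := ltnP i (size L); last by rewrite nth_default.
  by apply: contra N_notin => Ni; apply/flattenP; exists (nth [::] L i);
    rewrite ?mem_nth.
apply: allpairs_uniq_dep => [|i _|]; rewrite ?iota_uniq //.
pose block_index M := find (fun c : seq nat => N \in c) M.
pose letter_index M := index N (nth [::] M (block_index M)).
move=> _ _ /allpairsPdep[i [j [iL jc ->]]] /allpairsPdep[i' [j' [iL' jc' ->]]].
move: iL jc iL' jc'; rewrite !mem_index_iota /= => iL jc iL' jc' eqM.
have indexE k l : (k < size L)%N -> (l <= size (nth [::] L k))%N ->
    let M := take k L ++ (take l (nth [::] L k) ++ N :: drop l (nth [::] L k))
               :: drop k.+1 L in
    block_index M = k /\ letter_index M = l.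
  move=> kL lc M; have kE : block_index M = k.
    rewrite /block_index find_cat ifN /= ?mem_cat ?mem_head ?orbT ?addn0.
      by rewrite size_takel // ltnW.
    apply: contra N_notin => /hasP[c /mem_take cL Nc].
    by apply/flattenP; exists c.
  rewrite /letter_index kE; split=> //.
  rewrite nth_cat (size_takel (ltnW kL)) ltnn subnn /= index_cat.
  by rewrite (negbTE (contra (@mem_take _ _ _ _) (N_block k))) /= eqxx addn0
    size_takel.
move: (indexE i j iL jc); rewrite /= eqM.
by have /= [-> ->] := indexE i' j' iL' jc'; case=> -> ->.
Qed.

Fixpoint block_lists (N : nat) : seq (seq (seq nat)) :=
  if N is N'.+1 then
    [seq M | L <- block_lists N', M <- rcons L [:: N'] :: insertions N' L]
  else [:: [::]].

Lemma block_list_max_last N A B :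
  block_list N.+1 (A ++ [:: N] :: B) -> B = [::].
Proof.
case: B => // d B blockL; have dL : d \in A ++ [:: N] :: d :: B.
  by rewrite mem_cat !inE eqxx !orbT.
have /allP/(_ _ (min_letter_mem (block_neq_nil blockL dL))) :=
  block_lt blockL dL.
case/and3P: blockL => _ _; rewrite (sorted_pairwise ltn_trans) map_cat.
rewrite pairwise_cat /= [min_letter [:: N]]minnn.
by case/and3P=> _ _ /andP[/andP[lt_Nd _] _]; rewrite ltnNge lt_Nd.
Qed.

Lemma mem_block_lists N L : (L \in block_lists N) = block_list N L.
Proof.
elim: N L => [|N IH] L.
  rewrite inE /block_list; case: L => [|[|x c] L] //=; first by rewrite andbF.
  by apply/esym/negbTE/nandP; left; apply/negP => /perm_size.
apply/allpairsPdep/idP => [[M [L' []]]|blockL].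
  rewrite IH inE => blockM /predU1P[-> ->|]; first by rewrite block_list_rcons.
  case/insertionsP=> A c1 c2 B eqM -> ->; rewrite eqM in blockM.
  rewrite block_list_insert_max // (block_neq_nil blockM) //.
  by rewrite mem_cat mem_head orbT.
have : N \in flatten L by rewrite (mem_flatten_block_list blockL).
case/flattenP=> c /splitPr LE /splitPr cE.
case: cE LE => c1 c2 [A B] in blockL *.
have [c_nil|c_neq0] := eqVneq (c1 ++ c2) [::]; last first.
  exists (A ++ (c1 ++ c2) :: B), (A ++ (c1 ++ N :: c2) :: B).
  rewrite IH -block_list_insert_max // inE; split=> //.
  by apply/orP; right; apply/insertionsP; exists A c1 c2 B.
case: c1 c2 c_nil => [|//] [|//] _ /= in blockL *.
have B_nil := block_list_max_last blockL; rewrite B_nil cats1 in blockL *.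
by exists A, (rcons A [:: N]); rewrite IH -block_list_rcons mem_head.
Qed.

Definition delete_letter (N : nat) (M : seq (seq nat)) : seq (seq nat) :=
  [seq c <- [seq [seq x <- c | x != N] | c <- M] | c != [::]].

Lemma delete_letter_id N L : block_list N L -> delete_letter N L = L.
Proof.
move=> blockL; rewrite /delete_letter (_ : [seq _ | c <- L] = L).
  by apply/all_filterP/allP => c; apply: (block_neq_nil blockL).
rewrite -[RHS]map_id; apply/eq_in_map => c cL; apply/all_filterP.
by apply: (sub_all _ (block_lt blockL cL)) => x /ltn_eqF/negbT.
Qed.

Lemma delete_letterK N L M : block_list N L ->
  M \in rcons L [:: N] :: insertions N L -> delete_letter N M = L.
Proof.
move=> blockL; rewrite -[in RHS](delete_letter_id blockL) inE.
case/predU1P=> [->|/insertionsP[A c1 c2 B -> ->]].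
  by rewrite /delete_letter map_rcons filter_rcons /= eqxx.
by rewrite /delete_letter !map_cat /= !filter_cat /= eqxx.
Qed.

Lemma block_lists_uniq N : uniq (block_lists N).
Proof.
elim: N => // N IH; apply: allpairs_uniq_dep => // [L|].
  rewrite mem_block_lists => blockL /=; apply/andP; split.
    by apply/negP => /size_insertions; rewrite size_rcons => /esym/n_Sn.
  by rewrite uniq_insertions // (mem_flatten_block_list blockL) ltnn.
move=> p p' /allpairsPdep[L [M [blockL ML ->]]].
case/allpairsPdep=> L' [M' [blockL' ML' ->]].
rewrite /= !mem_block_lists in blockL blockL' * => eqM; rewrite -eqM in ML' *.
by rewrite -(delete_letterK blockL ML) (delete_letterK blockL' ML').
Qed.

(** * Insertion of the largest letter *)

Definition separated (s : nat) (c : seq nat) : bool :=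
  (count (ltn^~ s) c <= 1)%N.

Lemma separated_insert_max s N c1 c2 :
    c1 ++ c2 != [::] -> all (ltn^~ N) (c1 ++ c2) ->
  separated s (c1 ++ N :: c2) = (s <= N)%N && separated s (c1 ++ c2).
Proof.
rewrite /separated !count_cat /= -size_eq0 => c_neq0 /allP c_lt.
have [//|lt_Ns] := leqP s N.
have : all (ltn^~ s) (c1 ++ c2).
  by apply/allP => x /c_lt /= lt_xN; apply: ltn_trans lt_Ns.
rewrite all_count count_cat /= => /eqP c_full.
by rewrite addnCA c_full ltnS leqn0 (negbTE c_neq0).
Qed.

Lemma all_separated_insertions s N L M : block_list N L ->
  M \in insertions N L ->
  all (separated s) M = (s <= N)%N && all (separated s) L.
Proof.
move=> blockL /insertionsP[A c1 c2 B eqL ->]; rewrite eqL in blockL *.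
have cL : c1 ++ c2 \in A ++ (c1 ++ c2) :: B by rewrite mem_cat mem_head orbT.
have c_neq0 := block_neq_nil blockL cL; have c_lt := block_lt blockL cL.
rewrite !all_cat /= separated_insert_max //.
by case: (s <= N)%N; rewrite //= andbF.
Qed.

Definition block_sum (C : pred (seq nat)) (w : seq (seq nat) -> nat)
    (s N K : nat) : {poly int} :=
  \sum_(L <- block_lists N | [&& all C L, all (separated s) L & size L == K])
    'X^(w L).

Record insertion_law (C : pred (seq nat)) (w : seq (seq nat) -> nat)
    (a b : nat -> nat -> nat) : Prop := InsertionLaw {
  weight_nil : w [::] = 0%N;
  singleton_block : forall N, C [:: N];
  delete_block : forall N c1 c2, c1 ++ c2 != [::] ->
    all (ltn^~ N) (c1 ++ c2) -> C (c1 ++ N :: c2) -> C (c1 ++ c2);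
  weight_rcons : forall N L, block_list N L ->
    w (rcons L [:: N]) = (w L + a N (size L))%N;
  sum_weight_insertions : forall N L, block_list N L -> all C L ->
    \sum_(M <- insertions N L | all C M) 'X^(w M) =
      'X^(w L) * qnum (b N (size L)) }.

Section BlockSum.

Variables (C : pred (seq nat)) (w : seq (seq nat) -> nat).
Variables (a b : nat -> nat -> nat).
Hypothesis law : insertion_law C w a b.

Lemma all_block_insertions N L M :
  block_list N L -> M \in insertions N L -> all C M -> all C L.
Proof.
move=> blockL /insertionsP[A c1 c2 B eqL ->]; rewrite eqL in blockL *.
have cL : c1 ++ c2 \in A ++ (c1 ++ c2) :: B by rewrite mem_cat mem_head orbT.
rewrite !all_cat /= => /and3P[-> Cc ->]; rewrite andbT /=.
apply: (delete_block law) Cc; first exact: block_neq_nil blockL _ cL.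
exact: block_lt blockL _ cL.
Qed.

Lemma sum_separated_insertions s N L K : block_list N L ->
  \sum_(M <- insertions N L | [&& all C M, all (separated s) M & size M == K])
      'X^(w M) =
    (if (s <= N)%N then qnum (b N K) else 0) *
    (if [&& all C L, all (separated s) L & size L == K] then 'X^(w L) else 0).
Proof.
move=> blockL; rewrite big_seq_cond.
under eq_bigl => M.
  rewrite (_ : _ && _ =
      [&& (s <= N)%N, all C L, all (separated s) L & size L == K] &&
      ((M \in insertions N L) && all C M)).
    over.
  have [MI|] := boolP (M \in insertions N L); last by rewrite andbF.
  rewrite /= (all_separated_insertions s blockL MI) (size_insertions MI).
  by have := all_block_insertions blockL MI; case: (all C M) => [->|_];
    rewrite ?andbT ?andbF //= andbA.
have [_|_] /= := leqP s N; last by rewrite big_pred0 ?mul0r.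
case: ifP => [/and3P[CL _ /eqP<-]|_]; last by rewrite big_pred0 ?mulr0.
by rewrite mulrC -(sum_weight_insertions law) // -big_seq_cond.
Qed.

Lemma block_sum_rec s :
  triangular_rec (fun N K => 'X^(a N K))
    (fun N K => if (s <= N)%N then qnum (b N K) else 0) (block_sum C w s).
Proof.
move=> N K; pose term K' (L : seq (seq nat)) : {poly int} :=
  if [&& all C L, all (separated s) L & size L == K'] then 'X^(w L) else 0.
transitivity (\sum_(L <- block_lists N)
    ((if K is K'.+1 then 'X^(a N K') * term K' L else 0) +
     (if (s <= N)%N then qnum (b N K) else 0) * term K L)); last first.
  rewrite big_split -mulr_sumr -big_mkcond /=; congr (_ + _).
  by case: K => [|K]; [rewrite big1|rewrite -mulr_sumr -big_mkcond].
rewrite /block_sum big_mkcond big_allpairs_dep; apply: eq_big_seq => L.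
rewrite mem_block_lists => blockL.
rewrite big_cons -[X in _ + X = _]big_mkcond sum_separated_insertions //.
congr (_ + _); rewrite !all_rcons size_rcons (singleton_block law) /=.
have -> : separated s [:: N] by rewrite /separated /= addn0 leq_b1.
rewrite (weight_rcons law) //= /term.
case: K => [|K]; rewrite ?andbF // eqSS.
by case: ifP => [/and3P[_ _ /eqP->]|]; rewrite ?mulr0 // exprD mulrC.
Qed.

Lemma block_sum_le s N K : (N <= s)%N ->
  block_sum C w s N K = if K == N then 'X^(\sum_(j < N) a j j) else 0.
Proof.
elim: N K => [|N IH] K le_Ns.
  rewrite /block_sum big_cons big_nil /= (weight_nil law) big_ord0 eq_sym.
  by rewrite addr0.
rewrite block_sum_rec leqNgt le_Ns mul0r addr0.
case: K => // K; rewrite IH 1?ltnW // eqSS; case: eqP => [->|_].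
  by rewrite big_ord_recr /= addnC exprD.
by rewrite mulr0.
Qed.

Lemma block_sum_small s N K : (K < s <= N)%N -> block_sum C w s N K = 0.
Proof.
case/andP=> lt_Ks; elim: N K lt_Ks => [|N IH] K lt_Ks; first by case: s lt_Ks.
rewrite leq_eqVlt => /orP[/eqP<-|le_sN]; first by rewrite block_sum_le ?ltn_eqF.
rewrite block_sum_rec IH // mulr0 addr0.
by case: K lt_Ks => // K lt_Ks; rewrite IH ?mulr0 // ltnW.
Qed.

Lemma block_sum_shift_rec s :
  triangular_rec (fun n k => 'X^(a (n + s) (k + s)))
    (fun n k => qnum (b (n + s) (k + s)))
    (fun n k => block_sum C w s (n + s) (k + s)).
Proof.
move=> n k; rewrite addSn block_sum_rec leq_addl; case: k => [|k] //.
rewrite add0n; case: s => // s; congr (_ + _).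
by rewrite block_sum_small ?mulr0 ?ltnSn ?leq_addl.
Qed.

Lemma block_sum_shift0 s k :
  block_sum C w s (0 + s) (k + s) =
    if k == 0%N then 'X^(\sum_(j < s) a j j) else 0.
Proof. by rewrite block_sum_le // -[X in _ == X]add0n eqn_add2r. Qed.

Lemma block_sum_transfer m r d t u v u' v' :
    (forall n i, (n < i)%N -> t n i = 0) ->
    triangular_rec u v t ->
    (forall n i, (i <= n)%N -> d n.+1 i.+1 * u n i = u' n i * d n i) ->
    (forall n i, (i <= n)%N -> d n.+1 i * v n i = v' n i * d n i) ->
    (forall n i k, (i <= n)%N ->
       u' n i * 'X^(a (i + r) (k + r)) = 'X^(a (n + (m + r)) (k + (m + r)))) ->
    (forall n i k, (i <= n)%N ->
       v' n i + u' n i * qnum (b (i + r) (k + r)) =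
         qnum (b (n + (m + r)) (k + (m + r)))) ->
    'X^(\sum_(j < m + r) a j j) =
      d 0%N 0%N * t 0%N 0%N * 'X^(\sum_(j < r) a j j) ->
  forall n k, block_sum C w (m + r) (n + (m + r)) (k + (m + r)) =
    \sum_(0 <= i < n.+1) d n i * t n i * block_sum C w r (i + r) (k + r).
Proof.
move=> t_gt tS d_diag d_col u_comp v_comp base n k.
have dtS := triangular_rec_scale t_gt d_diag d_col tS.
apply: (triangular_rec_transfer (c := fun n i => d n i * t n i) _ u_comp v_comp
  dtS (@block_sum_shift_rec r) (@block_sum_shift_rec (m + r))).
- by move=> n' i lt_ni; rewrite t_gt ?mulr0.
- move=> k'; rewrite !block_sum_shift0.
  by case: eqP => _; rewrite ?mulr0.
Qed.

Lemma count_insertions N L : block_list N L -> all C L ->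
  count (all C) (insertions N L) = b N (size L).
Proof.
move=> blockL /(sum_weight_insertions law blockL).
move/(congr1 (fun p : {poly int} => p.[1])).
rewrite hornerM hornerXn expr1n mul1r horner_qnum1 horner_sum.
under eq_bigr do rewrite hornerXn expr1n.
by rewrite big_const_seq iter_addr_0 => /eqP; rewrite eqr_nat => /eqP.
Qed.

Lemma count_block_lists (bN : nat -> nat) N : (forall N' K, b N' K = bN N') ->
  count (all C) (block_lists N) = (\prod_(i < N) (bN i).+1)%N.
Proof.
move=> bE; elim: N => [|N IH]; first by rewrite big_ord0.
rewrite -sum1_count big_mkcond big_allpairs_dep big_ord_recr /= -IH mulnC.
rewrite -sum1_count big_distrr /= [RHS]big_mkcond /=; apply: eq_big_seq => L.
rewrite mem_block_lists => blockL.
rewrite big_cons -big_mkcond sum1_count all_rcons (singleton_block law).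
rewrite /= muln1.
case: ifP => [CL|/negbT nCL]; first by rewrite count_insertions ?bE.
apply/eqP; rewrite -leqn0 leqNgt -has_count; apply: contra nCL.
by case/hasP=> M MI; apply: all_block_insertions MI.
Qed.

End BlockSum.

(* The largest letter may be inserted in the middle of [c1 ++ c2] when
   [splittable c1 c2]; it then adds [size c2 + offset A B] to the weight. *)
Lemma sum_insertions_by_block (C : pred (seq nat)) (w : seq (seq nat) -> nat)
    (splittable : rel (seq nat))
    (offset : seq (seq nat) -> seq (seq nat) -> nat)
    (mu : seq nat -> nat) N L :
    (forall c1 c2, c1 ++ c2 != [::] -> all (ltn^~ N) (c1 ++ c2) ->
       C (c1 ++ N :: c2) = splittable c1 c2 && C (c1 ++ c2)) ->
    (forall A c1 c2 B, block_list N (A ++ (c1 ++ c2) :: B) ->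
       splittable c1 c2 ->
       w (A ++ (c1 ++ N :: c2) :: B) =
         (w (A ++ (c1 ++ c2) :: B) + offset A B + size c2)%N) ->
    (forall c, c != [::] ->
       \sum_(0 <= j < (size c).+1 | splittable (take j c) (drop j c))
         'X^(size c - j) = qnum (mu c)) ->
    block_list N L -> all C L ->
  \sum_(M <- insertions N L | all C M) 'X^(w M) =
    'X^(w L) * \sum_(0 <= i < size L)
      'X^(offset (take i L) (drop i.+1 L)) * qnum (mu (nth [::] L i)).
Proof.
move=> C_insert w_insert mu_sum blockL CL.
rewrite big_mkcond big_allpairs_dep mulr_sumr; apply: eq_big_nat => i /= iL.
set c := nth [::] L i; have cL : c \in L by apply: mem_nth.
have splitL : L = take i L ++ c :: drop i.+1 L.
  by rewrite -drop_nth ?cat_take_drop.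
have c_neq0 := block_neq_nil blockL cL.
have Cc := allP CL c cL; rewrite splitL all_cat /= Cc /= in CL.
rewrite mulrA -(mu_sum c c_neq0) mulr_sumr [RHS]big_mkcond.
apply: eq_big_nat => j; rewrite ltnS => /= jc.
have catc : take j c ++ drop j c = c by apply: cat_take_drop.
rewrite -/c all_cat /= C_insert ?catc ?(block_lt blockL cL) //.
rewrite Cc andbT andbCA CL andbT; case: ifP => // split_c.
by rewrite w_insert ?catc -?splitL // size_drop !exprD.
Qed.

(** * The three statistics *)

Fixpoint part_weight (j : nat) (L : seq (seq nat)) : nat :=
  if L is c :: L' then (j * size c + part_weight j.+1 L')%N else 0%N.

Lemma part_weight_cat j A B :
  part_weight j (A ++ B) = (part_weight j A + part_weight (j + size A) B)%N.
Proof.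
elim: A j => [|c A IH] j; first by rewrite addn0.
by rewrite /= IH addnA addSnnS.
Qed.

Lemma part_weightE j L :
  part_weight j L = (\sum_(i < size L) (j + i) * size (nth [::] L i))%N.
Proof.
elim: L j => [|c L IH] j; first by rewrite big_ord0.
rewrite big_ord_recl /= addn0 IH; congr addn.
by apply: eq_bigr => i _; rewrite addSnnS.
Qed.

Lemma sorted_insert_max N c1 c2 : all (ltn^~ N) (c1 ++ c2) ->
  sorted ltn (c1 ++ N :: c2) = nilp c2 && sorted ltn (c1 ++ c2).
Proof.
rewrite all_cat => /andP[c1_lt c2_lt].
rewrite !(sorted_pairwise ltn_trans) !pairwise_cat allrel_consr pairwise_cons.
rewrite c1_lt; case: c2 c2_lt => [|x c2] /=; first by rewrite !allrel0r.
by case/andP=> lt_xN _; rewrite ltnNge (ltnW lt_xN) /= !andbF.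
Qed.

Lemma part_law :
  insertion_law (sorted ltn) (part_weight 0) (fun _ K => K) (fun _ K => K).
Proof.
split=> // [N c1 c2 _ c_lt|N L _|N L blockL sL].
- by rewrite sorted_insert_max // => /andP[].
- by rewrite -cats1 part_weight_cat /= muln1 addn0.
rewrite (sum_insertions_by_block (splittable := fun _ c2 => nilp c2)
  (offset := fun A _ => (\sum_(c <- A) 1)%N) (mu := fun _ => 1%N)) //.
- by rewrite (qnum_sum_take [::] (fun=> 1%N)) sum1_size.
- by move=> c1 c2 _; apply: sorted_insert_max.
- move=> A c1 [|//] B _ _.
  by rewrite !part_weight_cat /= !size_cat sum1_size /=; lia.
- move=> c _; rewrite big_mkcond big_nat_recr //= drop_size subnn qnum1.
  rewrite big_nat_cond big1 ?add0r // => j /andP[/= jc _].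
  by rewrite /nilp size_drop subn_eq0 leqNgt jc.
Qed.

Lemma invE w :
  Defs.inv w = (\sum_(i < size w) \sum_(j < size w)
    ((i < j) && (nth 0 w j < nth 0 w i) : nat))%N.
Proof.
rewrite /Defs.inv -sum1dep_card big_mkcond pair_bigA /=.
by apply: eq_bigr => -[i j] _ /=; case: ifP.
Qed.

Lemma inv_nil : Defs.inv [::] = 0%N.
Proof. by rewrite invE big_ord0. Qed.

Lemma inv_cons x u : Defs.inv (x :: u) = (count (ltn^~ x) u + Defs.inv u)%N.
Proof.
rewrite !invE /= big_ord_recl; congr addn; last first.
  by apply: eq_bigr => i _; rewrite big_ord_recl.
rewrite big_ord_recl /= add0n -sum1_count (big_nth 0%N) big_mkord.
by rewrite [RHS]big_mkcond; apply: eq_bigr => j _ /=; case: ltnP.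
Qed.

Lemma inv_cons0 u : Defs.inv (0%N :: u) = Defs.inv u.
Proof. by rewrite inv_cons (eq_count (a2 := pred0)) ?count_pred0. Qed.

Lemma inv_insert_max x u v : all (ltn^~ x) (u ++ v) ->
  Defs.inv (u ++ x :: v) = (Defs.inv (u ++ v) + size v)%N.
Proof.
elim: u => [|y u IH] /=.
  by rewrite inv_cons all_count => /eqP->; rewrite addnC.
case/andP=> lt_yx /IH invI; rewrite !inv_cons invI !count_cat /=.
by rewrite ltnNge (ltnW lt_yx) addnA.
Qed.

(* The words of a Lah distribution are taken by decreasing minima, whence [rev];
   the extra leading 0 creates no inversion. *)
Definition zero_separated (L : seq (seq nat)) : seq nat :=
  flatten [seq 0%N :: [seq x.+1 | x <- c] | c <- rev L].

Lemma zero_separated_cat A B :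
  zero_separated (A ++ B) = zero_separated B ++ zero_separated A.
Proof. by rewrite /zero_separated rev_cat map_cat flatten_cat. Qed.

Lemma zero_separated_cons c L :
  zero_separated (c :: L) =
    zero_separated L ++ 0%N :: [seq x.+1 | x <- c].
Proof. by rewrite -cat1s zero_separated_cat /zero_separated /= cats0. Qed.

Lemma size_zero_separated L :
  size (zero_separated L) = (\sum_(c <- L) (size c).+1)%N.
Proof.
elim: L => [|c L IH]; first by rewrite big_nil.
by rewrite zero_separated_cons size_cat IH big_cons /= size_map addnC.
Qed.

Lemma zero_separated_lt N L : all (all (ltn^~ N)) L ->
  all (ltn^~ N.+1) (zero_separated L).
Proof.
elim: L => //= c L IH /andP[c_lt /IH L_lt].
by rewrite zero_separated_cons all_cat L_lt /= all_map.
Qed.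

Lemma lah_law : insertion_law predT (Defs.inv \o zero_separated) addn addn.
Proof.
have sum_size N L : block_list N L ->
    (\sum_(c <- L) (size c).+1 = N + size L)%N.
  move=> blockL; rewrite -(size_flatten_block_list blockL) size_flatten sumnE.
  rewrite big_map -sum1_size -big_split /=.
  by apply: eq_bigr => c _; rewrite addn1.
split=> // [|N L blockL|N L blockL _]; first exact: inv_nil.
- rewrite /= -cats1 zero_separated_cat /zero_separated /= inv_cons0.
  rewrite (@inv_insert_max N.+1 [::]) -/(zero_separated L).
    by rewrite size_zero_separated (sum_size N).
  exact/zero_separated_lt/block_list_all_lt.
rewrite (sum_insertions_by_block (splittable := fun _ _ => true)
  (offset := fun A _ => (\sum_(c <- A) (size c).+1)%N)
  (mu := fun c => (size c).+1)) //; last by apply/allP.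
- by rewrite (qnum_sum_take [::] (fun c => (size c).+1)) (sum_size N).
- move=> A c1 c2 B blockM _ /=.
  have := zero_separated_lt (block_list_all_lt blockM).
  rewrite !zero_separated_cat !zero_separated_cons !map_cat /= -!catA /=.
  rewrite -!(cat_cons 0%N) !(catA (zero_separated B)).
  rewrite -!(catA (zero_separated B ++ _)) => M_lt.
  rewrite inv_insert_max // size_cat size_map size_zero_separated.
  by rewrite addnAC addnA.
- by move=> c _; apply: qnum_rev.
Qed.

Definition min_headed (c : seq nat) : bool := head 0%N c == min_letter c.

Lemma min_headed_insert_max N c1 c2 :
    c1 ++ c2 != [::] -> all (ltn^~ N) (c1 ++ c2) ->
  min_headed (c1 ++ N :: c2) = ~~ nilp c1 && min_headed (c1 ++ c2).
Proof.
move=> c_neq0 c_lt; rewrite /min_headed min_letter_insert_max //.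
case: c1 => //= in c_neq0 c_lt *.
have := allP c_lt _ (min_letter_mem c_neq0).
by rewrite eq_sym => /ltn_eqF.
Qed.

Lemma cycle_law :
  insertion_law min_headed (Defs.inv \o flatten)
    (fun _ _ => 0%N) (fun N _ => N).
Proof.
split=> [|N|N c1 c2 c_neq0 c_lt|N L blockL|N L blockL hL].
- exact: inv_nil.
- by rewrite /min_headed /min_letter /= minnn.
- by rewrite min_headed_insert_max // => /andP[].
- rewrite /= flatten_rcons inv_insert_max cats0 //.
  by apply/allP => x; rewrite (mem_flatten_block_list blockL).
rewrite (sum_insertions_by_block (splittable := fun c1 _ => ~~ nilp c1)
  (offset := fun _ B => (\sum_(c <- B) size c)%N) (mu := size)) //.
- rewrite (qnum_sum_drop [::] size) -(size_flatten_block_list blockL).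
  by rewrite size_flatten sumnE big_map.
- exact: min_headed_insert_max.
- move=> A c1 c2 B blockM _ /=.
  have : all (ltn^~ N) (flatten (A ++ (c1 ++ c2) :: B)).
    by apply/allP => x; rewrite (mem_flatten_block_list blockM).
  rewrite !flatten_cat /= -!catA !(catA (flatten A)) => M_lt.
  by rewrite inv_insert_max // size_cat size_flatten sumnE big_map addnAC addnA.
- move=> c _; rewrite big_mkcond big_nat_recl //= take0 add0r.
  rewrite -[RHS]qnum_rev; apply: eq_big_nat => j /= jc.
  by rewrite /nilp size_takel.
Qed.

(** * Set partitions as lists of blocks *)

Section Minb.

Variable N : nat.
Implicit Types (B : {set 'I_N}) (P : {set {set 'I_N}}).

Lemma minb_le B (x : 'I_N) : x \in B -> (minb B <= x)%N.
Proof.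
rewrite /minb; elim: (index_enum _) (mem_index_enum x) => // y r IH.
rewrite inE big_cons => /predU1P[<- xB|xr xB]; first by rewrite xB geq_minl.
by case: ifP => _; rewrite ?(leq_trans (geq_minr _ _)) ?IH.
Qed.

Lemma minbE B (x : 'I_N) :
  x \in B -> (forall y, y \in B -> (x <= y)%N) -> minb B = x.
Proof.
move=> xB x_le; apply/anti_leq; rewrite minb_le //=.
rewrite /minb; elim/big_ind: _ => [|m n|//]; first exact/ltnW/ltn_ord.
by rewrite leq_min => -> ->.
Qed.

Lemma minb_mem B : B != set0 -> exists2 x : 'I_N, x \in B & minb B = x.
Proof.
case/set0Pn=> y yB; case: (@arg_minnP _ y [in B] val yB) => x xB x_le.
by exists x => //; apply: minbE.
Qed.

Lemma partition_minb_inj P D : partition P D -> {in P &, injective (@minb N)}.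
Proof.
case/and3P=> _ /trivIsetP trivP P0 A B AP BP eq_min; apply/eqP/contraT => neqAB.
have [x xA minA] := minb_mem (memPn P0 A AP).
have [y yB minB] := minb_mem (memPn P0 B BP).
have eq_xy : x = y by apply: val_inj; rewrite /= -minA eq_min.
by rewrite -eq_xy (disjointFr (trivP _ _ AP BP neqAB) xA) in yB.
Qed.

End Minb.

Definition values N (S : seq (seq 'I_N)) : seq (seq nat) :=
  [seq [seq val x | x <- s] | s <- S].

Definition supports N (S : seq (seq 'I_N)) : seq {set 'I_N} :=
  [seq [set x in s] | s <- S].

Lemma mem_map_val N (s : seq 'I_N) x : (val x \in map val s) = (x \in s).
Proof. exact/mem_map/val_inj. Qed.

Lemma values_inj N : injective (@values N).
Proof. exact/inj_map/inj_map/val_inj. Qed.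

Lemma values_surj N L :
  all (all (ltn^~ N)) L -> exists S : seq (seq 'I_N), values S = L.
Proof.
move=> L_lt; exists [seq pmap insub c | c <- L].
rewrite /values -map_comp -[RHS]map_id; apply/eq_in_map => c cL /=.
rewrite (pmap_filter (insubK _)); apply/all_filterP.
by apply: sub_all (allP L_lt c cL) => x /= x_lt; rewrite insubT.
Qed.

Lemma min_letter_val N (s : seq 'I_N) :
  s != [::] -> min_letter (map val s) = minb [set x in s].
Proof.
move=> s_neq0; have val_s_neq0 : map val s != [::] by case: (s) s_neq0.
have /mapP[x xs minx] := min_letter_mem val_s_neq0.
rewrite (minbE (x := x)) ?inE // => y; rewrite inE => ys.
by rewrite -[nat_of_ord x]minx min_letter_le ?map_f.
Qed.

Lemma separatedP r c : uniq c ->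
  reflect {in c &, forall x y, (x < r)%N -> (y < r)%N -> x = y} (separated r c).
Proof.
rewrite /separated -size_filter => uniq_c.
have := filter_uniq (ltn^~ r) uniq_c; have := mem_filter (ltn^~ r) ^~ c.
case: filter => [|x [|y l]] memF uniqF; constructor.
- by move=> x y xc _ lt_xr _; have := memF x; rewrite xc /= lt_xr.
- move=> z t zc tc lt_zr lt_tr; have := memF z; have := memF t.
  by rewrite zc tc /= lt_zr lt_tr !inE => /eqP-> /eqP->.
have := memF x; have := memF y; rewrite !inE !eqxx orbT.
case/esym/andP=> lt_yr yc /esym/andP[lt_xr xc] eq_c.
by move: uniqF; rewrite /= inE (eq_c x y) ?eqxx.
Qed.

Section Supports.

Variables (N : nat) (P : {set {set 'I_N}}) (S : seq (seq 'I_N)).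
Hypothesis PS : P =i supports S.

Lemma block_list_values :
    partition P [set: 'I_N] -> all uniq S ->
    sorted ltn [seq minb B | B <- supports S] ->
  block_list N (values S).
Proof.
move=> partP /allP S_uniq minS; have /and3P[_ _ P0] := partP.
have S_neq0 s : s \in S -> s != [::].
  move=> sS; apply: contraNneq P0 => s_nil; rewrite PS; apply/mapP.
  by exists s => //; apply/setP => x; rewrite s_nil !inE.
have sum_size : size (flatten (values S)) = N.
  rewrite size_flatten sumnE !big_map -[RHS]card_ord -cardsT.
  rewrite (card_partition partP) -big_enum /=.
  rewrite (perm_big (supports S)) ?big_map /=.
    by apply: eq_big_seq => s /S_uniq/card_uniqP; rewrite size_map cardsE.
  apply: uniq_perm; rewrite ?enum_uniq //.
    by apply: map_uniq (sorted_uniq ltn_trans ltnn minS).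
  by move=> B; rewrite mem_enum PS.
have iota_sub : {subset iota 0 N <= flatten (values S)}.
  move=> x; rewrite mem_iota => /= x_lt.
  have : Ordinal x_lt \in cover P by rewrite (cover_partition partP) inE.
  case/bigcupP=> B; rewrite PS => /mapP[s sS ->]; rewrite inE => xs.
  apply/flattenP; exists (map val s); first exact: map_f.
  by rewrite -[x]/(val (Ordinal x_lt)) mem_map_val.
apply/and3P; split.
- have le_size : (size (flatten (values S)) <= size (iota 0 N))%N.
    by rewrite sum_size size_iota.
  have [_ eq_iota] := uniq_min_size (iota_uniq 0 N) iota_sub le_size.
  apply: uniq_perm; rewrite ?iota_uniq //.
  exact: leq_size_uniq (iota_uniq 0 N) iota_sub le_size.
- by apply/mapP => -[s /S_neq0]; case: s.
- have -> // : map min_letter (values S) = [seq minb B | B <- supports S].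
  rewrite /values /supports -!map_comp; apply/eq_in_map => s /S_neq0.
  exact: min_letter_val.
Qed.

Hypothesis blockS : block_list N (values S).

Lemma support_neq0 s : s \in S -> [set x in s] != set0.
Proof.
move=> sS; have := block_neq_nil blockS (map_f _ sS).
by case: s {sS} => // x s _; apply/set0Pn; exists x; rewrite !inE eqxx.
Qed.

Lemma eq_support s t x : s \in S -> t \in S -> x \in s -> x \in t -> s = t.
Proof.
move=> sS tS; rewrite -!mem_map_val => xs xt; apply: (inj_map val_inj).
exact: (eq_block blockS (map_f _ sS) (map_f _ tS) xs xt).
Qed.

Lemma set_of_seq_inj : {in S &, injective (fun s => [set x in s])}.
Proof.
move=> s t sS tS eq_st; have /set0Pn[x] := support_neq0 sS.
rewrite inE => xs; have /setP/(_ x) := eq_st; rewrite !inE xs => /esym.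
exact: eq_support.
Qed.

Lemma supports_partition : partition P [set: 'I_N].
Proof.
apply/and3P; split.
- rewrite eqEsubset subsetT; apply/subsetP => x _.
  have : val x \in flatten (values S).
    by rewrite (mem_flatten_block_list blockS) /=.
  case/flattenP=> _ /mapP[s sS ->]; rewrite mem_map_val => xs.
  by apply/bigcupP; exists [set y in s]; rewrite ?inE // PS map_f.
- apply/trivIsetP => A B; rewrite !PS => /mapP[s sS ->] /mapP[t tS ->].
  apply: contraNT => /pred0Pn[x /andP[]] /=; rewrite !inE => xs xt.
  by rewrite (eq_support sS tS xs xt).
- by rewrite PS; apply/mapP => -[s /support_neq0/eqP + /esym].
Qed.

Lemma card_supports : #|P| = size S.
Proof.
rewrite (eq_card PS) -[RHS](size_map (fun s => [set x in s])).
apply/card_uniqP; rewrite (map_inj_in_uniq set_of_seq_inj).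
have /and3P[_ _ /(sorted_uniq ltn_trans ltnn)/map_uniq/map_uniq] := blockS.
by [].
Qed.

Lemma pblock_supports s x : s \in S -> x \in s -> pblock P x = [set y in s].
Proof.
move=> sS xs; have /and3P[_ trivP _] := supports_partition.
by apply: def_pblock; rewrite ?inE // PS map_f.
Qed.

Lemma distinct_blocks_supports r :
  distinct_blocks r P = all (separated r) (values S).
Proof.
apply/'forall_forallP/allP => [distP _ /mapP[s sS ->]|sepS x y].
  apply/separatedP; first by rewrite (block_uniq blockS) ?map_f.
  move=> _ _ /mapP[x xs ->] /mapP[y ys ->] lt_xr lt_yr.
  have := distP x y; rewrite !(pblock_supports sS) // eqxx.
  by rewrite lt_xr lt_yr implybF negbK => /eqP->.
apply/implyP => /and3P[lt_xr lt_yr]; apply: contraNneq => eq_xy.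
have coverP z : z \in cover P.
  by rewrite (cover_partition supports_partition) inE.
have := pblock_mem (coverP x); rewrite PS => /mapP[s sS pblockE].
have xs : val x \in map val s.
  by have := mem_pblock P x; rewrite coverP pblockE mem_map_val inE.
have ys : val y \in map val s.
  by have := mem_pblock P y; rewrite coverP -eq_xy pblockE mem_map_val inE.
have s_uniq := block_uniq blockS (map_f _ sS).
by apply/eqP/val_inj/(separatedP r s_uniq (sepS _ (map_f _ sS))).
Qed.

End Supports.

Lemma eq_mem_values N (S U : seq (seq 'I_N)) :
    block_list N (values S) -> block_list N (values U) -> S =i U -> S = U.
Proof.
move=> blockS blockU eqSU; apply: values_inj.
by apply: block_list_eq blockS blockU _; apply: eq_mem_map.
Qed.

Lemma sum_block_encoding (T : finType) (N : nat) (Q : pred T)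
    (P : T -> {set {set 'I_N}}) (S : T -> seq (seq 'I_N)) (v : T -> nat)
    (C : pred (seq nat)) (w : seq (seq nat) -> nat) s K :
    (forall t, Q t -> P t =i supports (S t)) ->
    (forall t, Q t -> block_list N (values (S t)) && all C (values (S t))) ->
    (forall t, Q t -> v t = w (values (S t))) ->
    {in Q &, injective S} ->
    (forall U, block_list N (values U) -> all C (values U) ->
       exists2 t, Q t & S t = U) ->
  \sum_(t | [&& Q t, #|P t| == K & distinct_blocks s (P t)]) 'X^(v t) =
    block_sum C w s N K.
Proof.
move=> PS blockS vE S_inj S_surj; rewrite /block_sum.
have image_perm : perm_eq [seq L <- block_lists N | all C L]
                          [seq values (S t) | t <- enum Q].
  apply: uniq_perm; first by rewrite filter_uniq ?block_lists_uniq.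
    rewrite map_inj_in_uniq ?enum_uniq // => t t'; rewrite !mem_enum => Qt Qt'.
    by move/values_inj; apply: S_inj.
  move=> L; rewrite mem_filter mem_block_lists andbC.
  apply/andP/mapP => [[blockL CL]|[t]]; last first.
    by rewrite mem_enum => /blockS/andP[? ?] ->.
  have [U eqU] := values_surj (block_list_all_lt blockL).
  rewrite -eqU in blockL CL *; have [t Qt <-] := S_surj U blockL CL.
  by exists t; rewrite ?mem_enum.
rewrite -[RHS]big_filter_cond (perm_big _ image_perm) big_map big_enum_cond /=.
apply: eq_big => [t|t /andP[/vE->] //]; rewrite unfold_in.
have [Qt|//] := boolP (Q t); have [blockSt _] := andP (blockS t Qt).
rewrite (card_supports (PS t Qt) blockSt).
by rewrite (distinct_blocks_supports (PS t Qt) blockSt) size_map /= andbC.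
Qed.

Lemma sorted_val_filter_enum N (a : pred 'I_N) :
  sorted ltn [seq val x | x <- enum 'I_N & a x].
Proof.
rewrite sorted_map; apply: sorted_filter => [y x z|]; first exact: ltn_trans.
by rewrite -[sorted _ _]sorted_map val_enum_ord iota_ltn_sorted.
Qed.

Lemma sorted_enum_val N (B : {set 'I_N}) :
  sorted ltn [seq val x | x <- enum B].
Proof. by rewrite {1}/enum_mem -enumT; apply: sorted_val_filter_enum. Qed.

Lemma enum_set_of_seq N (s : seq 'I_N) :
  sorted ltn [seq val x | x <- s] -> enum [set x in s] = s.
Proof.
move=> sorted_s; apply/(inj_map val_inj)/(irr_sorted_eq ltn_trans ltnn) => //.
  exact: sorted_enum_val.
by apply: eq_mem_map => x; rewrite mem_enum inE.
Qed.

(** * Encodings of the three structures *)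

Definition partition_blocks N (P : {set {set 'I_N}}) : seq (seq 'I_N) :=
  [seq enum B | B : {set 'I_N} <- blocks P].

Lemma mem_blocks N (P : {set {set 'I_N}}) : blocks P =i P.
Proof. by move=> B; rewrite mem_sort mem_enum. Qed.

Lemma supports_partition_blocks N (P : {set {set 'I_N}}) :
  supports (partition_blocks P) = blocks P.
Proof.
rewrite /supports -map_comp -[RHS]map_id; apply: eq_map => B.
exact: set_enum.
Qed.

Lemma block_list_partition_blocks N (P : {set {set 'I_N}}) :
  partition P [set: 'I_N] -> block_list N (values (partition_blocks P)).
Proof.
move=> partP; apply: (block_list_values _ partP).
- by move=> B; rewrite supports_partition_blocks mem_blocks.
- by apply/allP => _ /mapP[B _ ->]; apply: enum_uniq.
rewrite supports_partition_blocks ltn_sorted_uniq_leq sorted_map.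
rewrite sort_sorted ?andbT; last by move=> B D; apply: leq_total.
rewrite map_inj_in_uniq ?sort_uniq ?enum_uniq // => B D.
by rewrite !mem_blocks; apply: partition_minb_inj partP B D.
Qed.

Lemma SqE s n k :
  Sq s n k = block_sum (sorted ltn) (part_weight 0) s (n + s) (k + s).
Proof.
apply: (sum_block_encoding (P := id) (S := @partition_blocks (n + s))).
- by move=> P _ B; rewrite supports_partition_blocks mem_blocks.
- move=> P partP; rewrite block_list_partition_blocks //=.
  rewrite /values -map_comp all_map; apply/allP => B _.
  exact: sorted_enum_val.
- move=> P _; rewrite part_weightE /wpart !size_map; apply: eq_bigr => i _.
  by rewrite /values -map_comp (nth_map set0) //= size_map -cardE.
- move=> P P' _ _ eqP; apply/setP => B.
  by rewrite -!mem_blocks -!supports_partition_blocks eqP.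
- move=> U blockU /allP U_sorted; pose P := [set:: supports U].
  have PU : P =i supports U by move=> B; rewrite inE.
  have partP := supports_partition PU blockU.
  exists P => //.
  apply: eq_mem_values (block_list_partition_blocks partP) blockU _.
  have blocksU : blocks P =i supports U by move=> B; rewrite mem_blocks PU.
  move=> t; rewrite (eq_mem_map _ blocksU) /supports -map_comp.
  rewrite (_ : map _ U = U) // -[RHS]map_id; apply/eq_in_map => u uU /=.
  exact/enum_set_of_seq/U_sorted/map_f.
Qed.

Definition lah_blocks N (D : {set N.-bseq 'I_N}) : seq (seq 'I_N) :=
  rev [seq val W | W <- lah_words D].

Lemma mem_lah_blocks N (D : {set N.-bseq 'I_N}) (W : N.-bseq 'I_N) :
  (val W \in lah_blocks D) = (W \in D).
Proof.
by rewrite mem_rev mem_map ?mem_sort ?mem_enum //; apply: val_inj.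
Qed.

Lemma supports_lah_blocks N (D : {set N.-bseq 'I_N}) :
  supports (lah_blocks D) = rev [seq supp W | W <- lah_words D].
Proof. by rewrite /supports map_rev -map_comp. Qed.

Lemma underlyingE N (D : {set N.-bseq 'I_N}) :
  underlying D =i supports (lah_blocks D).
Proof.
move=> B; rewrite supports_lah_blocks mem_rev.
by apply/imsetP/mapP => -[W WD ->]; exists W;
  rewrite // mem_sort mem_enum in WD *.
Qed.

Lemma lah_supp_inj N (D : {set N.-bseq 'I_N}) :
  is_lah D -> {in D &, injective (@supp N)}.
Proof.
case/and3P=> _ _ /forall_inP inj_supp V W VD WD eqVW.
by have /forall_inP/(_ W WD)/implyP/(_ (introT eqP eqVW))/eqP := inj_supp V VD.
Qed.

Lemma block_list_lah_blocks N (D : {set N.-bseq 'I_N}) :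
  is_lah D -> block_list N (values (lah_blocks D)).
Proof.
move=> lahD; have [partD /forall_inP D_uniq _] := and3P lahD.
apply: (block_list_values (@underlyingE N D) partD).
  apply/allP => s; rewrite mem_rev => /mapP[W + ->].
  by rewrite mem_sort mem_enum; apply: D_uniq.
rewrite supports_lah_blocks map_rev -map_comp ltn_sorted_uniq_leq rev_uniq.
rewrite rev_sorted sorted_map sort_sorted ?andbT; last first.
  by move=> V W; apply: leq_total.
rewrite map_inj_in_uniq ?sort_uniq ?enum_uniq // => V W.
rewrite !mem_sort !mem_enum => VD WD eq_min; apply: (lah_supp_inj lahD) => //.
by apply: (partition_minb_inj partD) eq_min; apply: imset_f.
Qed.

Lemma inv_lah_word N (D : {set N.-bseq 'I_N}) :
  Defs.inv (lah_word D) = Defs.inv (zero_separated (values (lah_blocks D))).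
Proof.
rewrite /zero_separated /values /lah_blocks !map_rev revK -!map_comp /lah_word.
rewrite (eq_map (g := fun W : N.-bseq 'I_N =>
  0%N :: [seq x.+1 | x <- [seq val x | x <- val W]])).
  by case: (lah_words D) => [//|W s] /=; rewrite inv_cons0.
by move=> W; rewrite -map_comp.
Qed.

Lemma lah_blocks_surj N (U : seq (seq 'I_N)) : block_list N (values U) ->
  exists2 D : {set N.-bseq 'I_N}, is_lah D & lah_blocks D = U.
Proof.
move=> blockU; pose D := [set W : N.-bseq 'I_N | val W \in U].
have U_uniq u : u \in U -> uniq u.
  by move=> uU; apply: map_uniq (block_uniq blockU (map_f _ uU)).
have blocksD : lah_blocks D =i U.
  move=> u; apply/idP/idP => [|uU].
    by rewrite mem_rev => /mapP[W]; rewrite mem_sort mem_enum inE => WU ->.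
  have u_size : (size u <= N)%N.
    by rewrite -(card_uniqP (U_uniq u uU)) -[leqRHS]card_ord max_card.
  by have := mem_lah_blocks D (Bseq u_size); rewrite inE /= uU.
have underD : underlying D =i supports U.
  by move=> B; rewrite underlyingE; apply: eq_mem_map.
have lahD : is_lah D.
  apply/and3P; split; first exact: supports_partition underD blockU.
    by apply/forall_inP => W; rewrite inE => /U_uniq.
  apply/forall_inP => V; rewrite inE => VU; apply/forall_inP => W.
  rewrite inE => WU; apply/implyP => /eqP eqVW.
  exact/eqP/val_inj/(set_of_seq_inj blockU).
by exists D => //; apply: eq_mem_values (block_list_lah_blocks lahD) blockU _.
Qed.

Lemma LqE s n k :
  Lq s n k = block_sum predT (Defs.inv \o zero_separated) s (n + s) (k + s).
Proof.
rewrite -(sum_block_encoding (Q := @is_lah (n + s)) (P := @underlying (n + s))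
  (S := @lah_blocks (n + s)) (v := fun D => Defs.inv (lah_word D))).
- apply: eq_bigl => D; case lahD: (is_lah D) => //=.
  by rewrite card_in_imset //; apply: lah_supp_inj.
- by move=> D _; apply: underlyingE.
- by move=> D /block_list_lah_blocks->; apply/allP.
- by move=> D _; apply: inv_lah_word.
- move=> D D' _ _ eqD; apply/setP => W.
  by rewrite -!mem_lah_blocks eqD.
- by move=> U /lah_blocks_surj.
Qed.

Definition cycle_blocks N (p : {perm 'I_N}) : seq (seq 'I_N) :=
  [seq traject p x #|porbit p x| | x <- cycle_minima p].

Lemma porbits_partition (T : finType) (p : {perm T}) :
  partition (porbits p) [set: T].
Proof.
have -> : porbits p = preim_partition (porbit p) [set: T].
  by apply/setP => B; apply/imsetP/imsetP => -[x _ ->]; exists x => //;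
    apply/setP => y; rewrite !inE eq_porbit_mem porbit_sym.
exact: preim_partitionP.
Qed.

Lemma cycle_minimaP N (p : {perm 'I_N}) (x : 'I_N) :
  reflect (forall y, y \in porbit p x -> (x <= y)%N) (x \in cycle_minima p).
Proof. by rewrite mem_filter mem_enum andbT; apply: (iffP forall_inP). Qed.

Lemma minb_porbit N (p : {perm 'I_N}) x :
  x \in cycle_minima p -> minb (porbit p x) = x.
Proof. by move/cycle_minimaP; apply: minbE; apply: porbit_id. Qed.

Lemma supports_cycle_blocks N (p : {perm 'I_N}) :
  supports (cycle_blocks p) = [seq porbit p x | x <- cycle_minima p].
Proof.
rewrite /supports -map_comp; apply: eq_map => x.
by apply/setP => y; rewrite inE porbit_traject.
Qed.

Lemma porbitsE N (p : {perm 'I_N}) : porbits p =i supports (cycle_blocks p).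
Proof.
move=> B; rewrite supports_cycle_blocks.
apply/imsetP/mapP => [[x _ ->]|[x _ ->]]; last by exists x.
have [|y yx miny] := @minb_mem _ (porbit p x).
  by apply/set0Pn; exists x; apply: porbit_id.
have eq_yx : porbit p y = porbit p x by apply/eqP; rewrite eq_porbit_mem.
exists y => //; apply/cycle_minimaP => z; rewrite eq_yx -miny.
exact: minb_le.
Qed.

Lemma block_list_cycle_blocks N (p : {perm 'I_N}) :
  block_list N (values (cycle_blocks p)).
Proof.
apply: (block_list_values (porbitsE p) (porbits_partition p)).
  by apply/allP => _ /mapP[x _ ->]; apply: uniq_traject_porbit.
rewrite supports_cycle_blocks -map_comp.
rewrite (eq_in_map _ val _).1 => [|x /minb_porbit //].
exact: sorted_val_filter_enum.
Qed.

Lemma cycle_blocks_min_headed N (p : {perm 'I_N}) :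
  all min_headed (values (cycle_blocks p)).
Proof.
apply/allP => _ /mapP[_ /mapP[x xmin ->] ->]; apply/eqP.
have traj_neq0 : traject p x #|porbit p x| != [::].
  by rewrite -size_eq0 size_traject card_porbit_neq0.
rewrite min_letter_val // (_ : [set y in _] = porbit p x).
  by rewrite minb_porbit //; case: #|_| (card_porbit_neq0 p x).
by apply/setP => y; rewrite inE porbit_traject.
Qed.

Lemma fcycle_traject_porbit (T : finType) (p : {perm T}) x :
  fcycle p (traject p x #|porbit p x|).
Proof.
have := iter_porbit p x; case: #|_| (card_porbit_neq0 p x) => // m _ iterE.
by rewrite /= -[X in rcons _ X]iterE iterSr -trajectSr fpath_traject.
Qed.

Lemma cycle_blocks_inj N : injective (@cycle_blocks N).
Proof.
move=> p p' eqp; apply/permP => x.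
have : porbit p x \in porbits p by apply: imset_f.
rewrite porbitsE => /mapP[s sp supp_s].
have xs : x \in s by have := porbit_id p x; rewrite supp_s inE.
have nextE q : s \in cycle_blocks q -> next s x = q x.
  by case/mapP=> y _ eq_s; apply: nextE xs; rewrite eq_s fcycle_traject_porbit.
by rewrite -(nextE p) // -(nextE p') // -eqp.
Qed.

(* [cycle_blocks] is injective, and its domain and codomain both have N!
   elements. *)
Lemma cycle_blocks_surj N (U : seq (seq 'I_N)) :
  block_list N (values U) -> all min_headed (values U) ->
  exists p : {perm 'I_N}, cycle_blocks p = U.
Proof.
move=> blockU headU.
pose encodings := [seq values (cycle_blocks p) | p : {perm 'I_N}].
pose target := [seq L <- block_lists N | all min_headed L].
have encodings_uniq : uniq encodings.
  by rewrite map_inj_uniq ?enum_uniq // => p p' /values_inj/cycle_blocks_inj.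
have sub_target : {subset encodings <= target}.
  move=> _ /mapP[p _ ->]; rewrite mem_filter cycle_blocks_min_headed.
  by rewrite mem_block_lists block_list_cycle_blocks.
have size_target : (size target <= size encodings)%N.
  rewrite size_filter (count_block_lists cycle_law (bN := id)) //.
  rewrite size_map -cardE card_Sn.
  by rewrite fact_prod big_add1 big_mkord.
have [_ eq_target] := uniq_min_size encodings_uniq sub_target size_target.
have : values U \in target by rewrite mem_filter headU mem_block_lists.
by rewrite -eq_target => /mapP[p _ /values_inj->]; exists p.
Qed.

Lemma cqE s n k :
  cq s n k = block_sum min_headed (Defs.inv \o flatten) s (n + s) (k + s).
Proof.
rewrite -(sum_block_encoding (Q := xpredT) (P := @porbits _)
  (S := @cycle_blocks (n + s)) (v := fun p => Defs.inv (cycle_word p))) //.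
- by move=> p _; apply: porbitsE.
- by move=> p _; rewrite block_list_cycle_blocks cycle_blocks_min_headed.
- by move=> p _; rewrite /cycle_word /= /values -map_comp.
- by move=> p p' _ _; apply: cycle_blocks_inj.
- by move=> U blockU /(cycle_blocks_surj blockU)[p <-]; exists p.
Qed.

(** * The three identities *)

Lemma sum_ordD m r :
  (\sum_(j < m + r) j = 'C(m, 2) + m * r + \sum_(j < r) j)%N.
Proof.
rewrite big_split_ord /= -bin2_sum big_mkord -addnA; congr addn.
by rewrite big_split /= sum_nat_const card_ord mulnC.
Qed.

Lemma Sq_transfer m r n k :
  Sq (m + r) n k = \sum_(0 <= i < n.+1)
    'X^(m * (i + r) + 'C(m, 2)) * qnum m ^+ (n - i) * ('C(n, i))%:R * Sq r i k.
Proof.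
rewrite SqE; under eq_bigr do rewrite SqE.
apply: (block_sum_transfer part_law
  (d := fun n i => 'X^(m * (i + r) + 'C(m, 2)) * qnum m ^+ (n - i))
  (u' := fun _ _ => 'X^m) (v' := fun _ _ => qnum m) _ (@bin_rec _)).
- by move=> n' i /bin_small->.
- by move=> n' i _; rewrite mulr1 subSS addSn mulnS -addnA exprD mulrA.
- by move=> n' i le_in; rewrite mulr1 subSn // exprS mulrCA.
- by move=> _ i k' _; rewrite -exprD addnCA.
- by move=> _ i k' _; rewrite -qnumD addnCA.
- by rewrite sum_ordD !mulr1 -exprD; congr 'X^_; lia.
Qed.

Lemma Lq_transfer m r n k :
  Lq (m + r) n k = \sum_(0 <= i < n.+1)
    'X^(m * (2 * i + 2 * r + m - 1)) * qrising (2 * m) (n - i) * qbinom n i *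
    Lq r i k.
Proof.
rewrite LqE; under eq_bigr do rewrite LqE.
apply: (block_sum_transfer lah_law
  (d := fun n i => 'X^(m * (2 * i + 2 * r + m - 1)) * qrising (2 * m) (n - i))
  (u' := fun n i => 'X^(2 * m + (n - i)))
  (v' := fun n i => qnum (2 * m + (n - i))) qbinom_small qbinom_rec).
- move=> n' i _; rewrite subSS.
  have -> : (m * (2 * i.+1 + 2 * r + m - 1) =
             m * (2 * i + 2 * r + m - 1) + 2 * m)%N by case: (m) => // m'; nia.
  by rewrite !exprD; ring.
- by move=> n' i le_in; rewrite mulr1 subSn // qrisingS; ring.
- by move=> n' i k' le_in; rewrite -exprD; congr 'X^_; lia.
- by move=> n' i k' le_in; rewrite -qnumD; congr qnum; lia.
- have bin2_double : ('C(m, 2) + 'C(m, 2) = m * (m - 1))%N.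
    by rewrite addnn -muln2 (bin_ffact m 2) ffactnSr ffactn1.
  rewrite !big_split /= !sum_ordD qbinomn0 qrising0 !mulr1 -exprD.
  congr 'X^_; rewrite addnACA; congr addn; rewrite addnACA bin2_double -!mulnDr.
  by case: (m) => // m'; congr muln; lia.
Qed.

Lemma cq_transfer m r n k :
  cq (m + r) n k = \sum_(0 <= i < n.+1)
    'X^(r * (n - i)) * qrising m (n - i) * qbinom n i * cq r i k.
Proof.
rewrite cqE; under eq_bigr do rewrite cqE.
apply: (block_sum_transfer cycle_law
  (d := fun n i => 'X^(r * (n - i)) * qrising m (n - i)) (u' := fun _ _ => 1)
  (v' := fun n i => 'X^(r + i) * qnum (m + (n - i)))
  qbinom_small qbinom_rec_sym).
- by move=> n' i _; rewrite subSS mulr1 mul1r.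
- by move=> n' i le_in; rewrite subSn // qrisingS mulnS !exprD; ring.
- by move=> n' i k' _; rewrite mul1r.
- move=> n' i k' le_in; rewrite mul1r addrC [(r + i)%N]addnC -qnumD.
  by congr qnum; lia.
- by rewrite !big1 // muln0 qrising0 qbinomn0 !mulr1.
Qed.

Theorem theorem2p7 (m n r k : nat) :
  [/\ Sq (m + r) n k =
        \sum_(0 <= i < n.+1)
           'X^(m * (i + r) + 'C(m, 2)) * qnum m ^+ (n - i) *
           ('C(n, i))%:R * Sq r i k,
      Lq (m + r) n k =
        \sum_(0 <= i < n.+1)
           'X^(m * (2 * i + 2 * r + m - 1)) * qrising (2 * m) (n - i) *
           qbinom n i * Lq r i k
    & cq (m + r) n k =
        \sum_(0 <= i < n.+1)
           'X^(r * (n - i)) * qrising m (n - i) * qbinom n i * cq r i k].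
Proof.
split; [exact: Sq_transfer|exact: Lq_transfer|exact: cq_transfer].
Qed.
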